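(* Let $s\in\{\mathbf{f},\mathbf{i},\mathbf{li}\}$. There exist a PTRS $\mathcal{P}$ and signatures $\Sigma\subsetneq\Sigma'$ such that $\mathtt{PAST}(\xrightarrow{s}_{\mathcal{P}})$ holds when terms range over the signature $\Sigma$, but does not hold when terms range over $\Sigma'$.
   Context: Terms $\mathcal{T}$ are built from a (countable) signature and countable variables; a PTRS over a signature only uses symbols of that signature. $\mathrm{FDist}(A)$: finite multisets of pairs $(p:a)$, $0<p\le1$, probabilities summing to 1; $p\cdot\mu$ as usual. A PTRS is a countable set $\mathcal{P}$ of rules $\ell\to\mu$, $\ell$ non-variable, $\mu\in\mathrm{FDist}(\mathcal{T})$, variables of each term in $\mu$ among those of $\ell$. $t\xrightarrow{\mathbf{f}}_{\mathcal{P}}\{p_1:t_1,\dots,p_k:t_k\}$ iff $t|_\pi=\ell\sigma$, $t_j=t[r_j\sigma]_\pi$ for a position $\pi$, rule $\ell\to\{p_1:r_1,\dots,p_k:r_k\}$, substitution $\sigma$; innermost ($\xrightarrow{\mathbf{i}}_{\mathcal{P}}$) if all proper subterms of $\ell\sigma$ are normal forms (terms admitting no step); leftmost-innermost ($\xrightarrow{\mathbf{li}}_{\mathcal{P}}$) if innermost and there is no redex at a position parallel to and left of $\pi$. Lifting $\rightrightarrows$ of $\to$: smallest relation on multi-distributions with $\{1:t\}\rightrightarrows\{1:t\}$ for normal forms, $\{1:t\}\rightrightarrows\mu$ if $t\to\mu$, closed under $\bigcup_jp_j\cdot\mu_j\rightrightarrows\bigcup_jp_j\cdot\nu_j$ ($\sum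 p_j=1$). $|\mu|_\to$: total probability of normal forms in $\mu$. $\mathtt{PAST}(\to)$: every infinite $\rightrightarrows$-sequence $(\mu_n)$ with $\mu_0=\{1:t\}$ for a term $t$ satisfies $\sum_{n\ge0}(1-|\mu_n|_\to)<\infty$. *)

(* Defs.v *)
From HB Require Import structures.
From mathcomp Require Import all_boot all_order all_algebra.
From mathcomp Require Import finmap multiset.
From mathcomp Require Import all_classical all_reals all_analysis.

Set Implicit Arguments.
Unset Strict Implicit.
Unset Printing Implicit Defensive.

Import Order.TTheory GRing.Theory Num.Theory.

Local Open Scope classical_set_scope.
Local Open Scope ring_scope.

(** * Multi-distributions and probabilistic abstract reduction systems *)

(* Finite multisets of pairs (p : a), before the constraints on the p's. *)
Notation multidist R A := ({mset (R * A)%type}%mset).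

Section Distributions.
Variable R : realType.

Definition is_fdist (A : choiceType) (mu : multidist R A) : Prop :=
  {in mu, forall x, 0 < x.1 <= 1} /\ \sum_(x <- mu) x.1 = 1.

Definition scale_dist (A : choiceType) (p : R) (mu : multidist R A) :
  multidist R A := seq_mset [seq (p * x.1, x.2) | x <- mu].

Definition map_dist (A B : choiceType) (f : A -> B) (mu : multidist R A) :
  multidist R B := seq_mset [seq (x.1, f x.2) | x <- mu].

Definition dirac_dist (A : choiceType) (a : A) : multidist R A :=
  [mset (1, a)]%mset.

Section Lifting.
Variables (A : choiceType) (step : A -> multidist R A -> Prop).

Definition normal_form (a : A) : Prop := ~ exists mu, step a mu.

Inductive lifting : multidist R A -> multidist R A -> Prop :=
| lifting_nf a : normal_form a -> lifting (dirac_dist a) (dirac_dist a)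
| lifting_step a mu : step a mu -> lifting (dirac_dist a) mu
| lifting_convex k (p : 'I_k -> R) (mu nu : 'I_k -> multidist R A) :
    (forall j, 0 < p j) -> \sum_(j < k) p j = 1 ->
    (forall j, lifting (mu j) (nu j)) ->
    lifting (\big[@msetD _/mset0]_(j < k) scale_dist (p j) (mu j))
            (\big[@msetD _/mset0]_(j < k) scale_dist (p j) (nu j)).

Definition nf_prob (mu : multidist R A) : R :=
  \sum_(x <- mu | `[< normal_form x.2 >]) x.1.

Definition PAST : Prop :=
  forall (a : A) (mu : nat -> multidist R A),
    mu 0%N = dirac_dist a ->
    (forall n, lifting (mu n) (mu n.+1)) ->
    (\sum_(0 <= n <oo) (1 - nf_prob (mu n))%:E < +oo)%E.

End Lifting.
End Distributions.

(** * Terms *)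

(* Trees over an ambient countable set F of function symbols, in which a symbol
   may be given any number of arguments; the terms over a signature are the
   well-formed ones, see [term] below. *)
Inductive tree (F : Type) : Type :=
| Var of nat
| App of F & seq (tree F).
Arguments Var {F}.

Section TreeCountable.
Variable F : countType.

Fixpoint tree_encode (t : tree F) : GenTree.tree (nat + F) :=
  match t with
  | Var x => GenTree.Leaf (inl x)
  | App f ts => GenTree.Node 0 (GenTree.Leaf (inr f) :: map tree_encode ts)
  end.

Fixpoint tree_decode (g : GenTree.tree (nat + F)) : option (tree F) :=
  match g with
  | GenTree.Leaf (inl x) => Some (Var x)
  | GenTree.Node _ (GenTree.Leaf (inr f) :: gs) =>
      Some (App f (pmap tree_decode gs))
  | _ => None
  end.

Lemma tree_encodeK : pcancel tree_encode tree_decode.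
Proof.
rewrite /pcancel; fix IH 1 => -[x|f ts] //=; congr (Some (App f _)).
by elim: ts => //= t ts; rewrite IH /= => ->.
Qed.

HB.instance Definition _ := Countable.copy (tree F) (pcan_type tree_encodeK).

End TreeCountable.

Section Terms.
Variables (F : countType) (ar : F -> nat).

(* A signature is a set S of symbols of F, with arities given by ar. *)
Fixpoint wf (S : set F) (t : tree F) : bool :=
  match t with
  | Var _ => true
  | App f ts => [&& f \in S, size ts == ar f & all (wf S) ts]
  end.

Record term (S : set F) := Term { term_val :> tree F; _ : wf S term_val }.

HB.instance Definition _ (S : set F) := [isSub for @term_val S].
HB.instance Definition _ (S : set F) := [Countable of term S by <:].

End Terms.

Section TreeOperations.
Variable F : countType.
Implicit Types (t u v : tree F) (pi tau : seq nat).

Fixpoint vars t : seq nat :=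
  match t with
  | Var x => [:: x]
  | App _ ts => flatten (map vars ts)
  end.

Definition is_var t : bool := if t is Var _ then true else false.

Fixpoint subst (sigma : nat -> tree F) t : tree F :=
  match t with
  | Var x => sigma x
  | App f ts => App f (map (subst sigma) ts)
  end.

(* Argument positions are numbered from 0. *)
Fixpoint subtree_at t pi : option (tree F) :=
  match pi, t with
  | [::], _ => Some t
  | i :: pi', App _ ts =>
      if (i < size ts)%N then subtree_at (nth t ts i) pi' else None
  | _ :: _, Var _ => None
  end.

(* replace_at t pi u is t[u]_pi when pi is a position of t, and t otherwise. *)
Fixpoint replace_at t pi u : tree F :=
  match pi, t with
  | [::], _ => u
  | i :: pi', App f ts =>
      if (i < size ts)%N
      then App f (set_nth t ts i (replace_at (nth t ts i) pi' u)) else t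
  | _ :: _, Var _ => t
  end.

Definition proper_subtree v u : Prop :=
  exists2 pi, pi != [::] & subtree_at u pi = Some v.

Definition parallel_left tau pi : Prop :=
  exists (rho tau' pi' : seq nat) (i j : nat),
    [/\ tau = rho ++ i :: tau', pi = rho ++ j :: pi' & (i < j)%N].

End TreeOperations.

(** * Probabilistic term rewriting *)

Inductive strategy := Full | Innermost | LeftmostInnermost.

Section Rewriting.
Variables (R : realType) (F : countType) (ar : F -> nat).

Definition rule : Type := (tree F * multidist R (tree F))%type.

Definition is_PTRS (S : set F) (P : set rule) : Prop :=
  countable P /\
  forall l rho, P (l, rho) ->
    [/\ wf ar S l, ~~ is_var l, is_fdist rho
      & {in rho, forall x, wf ar S x.2 /\ {subset vars x.2 <= vars l}}].

Variables (S : set F) (P : set rule).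
Implicit Types (t : term ar S) (mu : multidist R (term ar S))
  (sigma : nat -> term ar S) (pi : seq nat).

Definition rewrites_at t mu (l : tree F) sigma pi : Prop :=
  exists rho, [/\ P (l, rho), subtree_at t pi = Some (subst sigma l)
    & map_dist (@term_val F ar S) mu
      = map_dist (fun r => replace_at t pi (subst sigma r)) rho].

Definition full_step t mu : Prop :=
  exists l sigma pi, rewrites_at t mu l sigma pi.

Definition innermost_redex (u : tree F) : Prop :=
  forall v : term ar S, proper_subtree v u -> normal_form full_step v.

Definition redex_at t pi : Prop :=
  exists l rho sigma, P (l, rho) /\ subtree_at t pi = Some (subst sigma l).

Definition innermost_step t mu : Prop :=
  exists l sigma pi,
    rewrites_at t mu l sigma pi /\ innermost_redex (subst sigma l).

Definition leftmost_innermost_step t mu : Prop :=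
  exists l sigma pi,
    [/\ rewrites_at t mu l sigma pi, innermost_redex (subst sigma l)
      & ~ exists2 tau, parallel_left tau pi & redex_at t tau].

Definition rewrite_step (s : strategy) :
  term ar S -> multidist R (term ar S) -> Prop :=
  match s with
  | Full => full_step
  | Innermost => innermost_step
  | LeftmostInnermost => leftmost_innermost_step
  end.

End Rewriting.

Arguments rewrite_step {R F} ar S P s _ _.

(* Main.v *)
From HB Require Import structures.
Require Import Defs.
From mathcomp Require Import all_boot all_order all_algebra.
From mathcomp Require Import finmap multiset.
From mathcomp Require Import all_classical all_reals all_analysis.
From mathcomp Require Import lra.

Set Implicit Arguments.
Unset Strict Implicit.
Unset Printing Implicit Defensive.

Import Order.TTheory GRing.Theory Num.Theory.

Local Open Scope classical_set_scope.
Local Open Scope ring_scope.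

(** The signature of constants is Coin k, Stop k, Choose, Count m, with the rules
    Coin k -> {1/2 : Coin k+1, 1/2 : Stop k}, Choose -> {1 : Count m} for all m,
    and Count m+1 -> {1 : Count m}.  A constant runs in finite expected time under
    every schedule, but the runtime of Choose is unbounded over the schedules.
    A fresh binary symbol Pair lets a schedule correlate the two: from
    Pair(Coin 0, Choose) it first tosses until Pair(Stop k, Choose) is reached,
    with probability 2^-(k+1), and then picks Count 2^(k+1), so that every k
    contributes 1 to the expected runtime.  All redexes are constants and the coin
    stands on the left, so that this schedule is leftmost-innermost. *)

(** * Multisets presented by sequences *)

Section SeqMset.
Variable K : choiceType.

Lemma seq_mset_cat (s t : seq K) :
  seq_mset (s ++ t) = msetD (seq_mset s) (seq_mset t).
Proof. by apply/msetP => a; rewrite msetE2 !mset_seqE count_cat. Qed.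

Lemma seq_mset1 (a : K) : seq_mset [:: a] = [mset a]%mset.
Proof. by apply/msetP => b; rewrite mset_seqE msetnE /= addn0 eq_sym; case: eqP. Qed.

Lemma seq_mset_nil : seq_mset [::] = mset0 :> {mset K}%mset.
Proof. by apply/msetP => b; rewrite mset_seqE mset0E. Qed.

Lemma mem_seq_mset (s : seq K) : seq_mset s =i s.
Proof. exact/perm_mem/perm_eq_seq_mset. Qed.

Lemma big_seq_mset (V : zmodType) (s : seq K) (p : pred K) (f : K -> V) :
  \sum_(x <- seq_mset s | p x) f x = \sum_(x <- s | p x) f x.
Proof. exact/perm_big/perm_eq_seq_mset. Qed.

Lemma big_msetD_flatten (s : seq (seq K)) :
  \big[@msetD _/mset0]_(x <- s) seq_mset x = seq_mset (flatten s).
Proof.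
elim: s => [|x s IHs] /=; first by rewrite big_nil seq_mset_nil.
by rewrite big_cons IHs seq_mset_cat.
Qed.

End SeqMset.

(** * Expectations under multi-distributions *)

Section Expectation.
Variables (R : realType) (A : choiceType).
Implicit Types (mu nu : multidist R A) (f g : A -> R).

Definition expect mu f : R := \sum_(x <- mu) x.1 * f x.2.

Lemma expect_seq_mset (s : seq (R * A)) f :
  expect (seq_mset s) f = \sum_(x <- s) x.1 * f x.2.
Proof. exact: big_seq_mset. Qed.

Lemma expect_dirac a f : expect (dirac_dist R a) f = f a.
Proof. by rewrite /dirac_dist -seq_mset1 expect_seq_mset big_seq1 mul1r. Qed.

Lemma scale_seq_mset p (s : seq (R * A)) :
  scale_dist p (seq_mset s) = seq_mset [seq (p * x.1, x.2) | x <- s].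
Proof. by apply/eq_seq_msetP/perm_map/perm_eq_seq_mset. Qed.

Lemma expect_scale p mu f : expect (scale_dist p mu) f = p * expect mu f.
Proof.
rewrite expect_seq_mset big_map mulr_sumr.
by apply: eq_bigr => x _; rewrite /= mulrA.
Qed.

Lemma expect_big k (mu : 'I_k -> multidist R A) f :
  expect (\big[@msetD _/mset0]_(j < k) mu j) f = \sum_(j < k) expect (mu j) f.
Proof.
rewrite (eq_bigr (fun j => seq_mset (mu j))) => [|j _]; last by rewrite seq_mset_id.
rewrite -(big_map (fun j => mu j : seq _) xpredT) big_msetD_flatten.
by rewrite expect_seq_mset big_flatten big_map.
Qed.

Lemma expectB mu f g : expect mu (fun a => f a - g a) = expect mu f - expect mu g.
Proof. by rewrite /expect -sumrB; apply: eq_bigr => x _; rewrite mulrBr. Qed.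

Lemma mem_scale_supp p mu x :
  x \in scale_dist p mu -> exists2 y, y \in mu & x.2 = y.2.
Proof. by rewrite mem_seq_mset => /mapP[y ymu ->]; exists y. Qed.

Lemma mem_scale_dist p mu x : x \in mu -> (p * x.1, x.2) \in scale_dist p mu.
Proof. by move=> xmu; rewrite mem_seq_mset; apply/mapP; exists x. Qed.

Lemma mem_bigmsetD k (mu : 'I_k -> multidist R A) x :
  reflect (exists j, x \in mu j) (x \in \big[@msetD _/mset0]_(j < k) mu j).
Proof.
rewrite (eq_bigr (fun j => seq_mset (mu j))) => [|j _]; last by rewrite seq_mset_id.
rewrite -(big_map (fun j => mu j : seq _) xpredT) big_msetD_flatten mem_seq_mset.
apply: (iffP flatten_mapP) => [[j _ xj]|[j xj]]; exists j => //.
by rewrite mem_index_enum.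
Qed.

End Expectation.

Lemma map_dist_seq_mset (R : realType) (A B : choiceType) (h : A -> B)
    (s : seq (R * A)) :
  map_dist h (seq_mset s) = seq_mset [seq (x.1, h x.2) | x <- s].
Proof. exact/eq_seq_msetP/perm_map/perm_eq_seq_mset. Qed.

Lemma expect_map (R : realType) (A B : choiceType) (h : A -> B)
    (mu : multidist R A) (f : B -> R) :
  expect (map_dist h mu) f = expect mu (f \o h).
Proof. by rewrite expect_seq_mset big_map. Qed.

(** * Upper bounds on the runtime by ranking functions *)

Section Rank.
Variables (R : realType) (A : choiceType) (step : A -> multidist R A -> Prop).
Implicit Types (mu nu : multidist R A) (f g : A -> R) (D : A -> Prop).

Definition in_supp D mu : Prop := {in mu, forall x, D x.2}.

(** Two predicates are allowed so that the lemma also covers a step that enters [D'] from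
    outside. *)
Lemma lifting_supp D D' :
  (forall a, D a -> normal_form step a -> D' a) ->
  (forall a nu, D a -> step a nu -> in_supp D' nu) ->
  forall mu nu, lifting step mu nu -> in_supp D mu -> in_supp D' nu.
Proof.
move=> Dnf Dstep mu nu; elim=> [a nfa|a {}nu st|k p {}mu {}nu _ _ _ IH] Dmu.
- have Da : D a by apply: (Dmu (1, a)); rewrite in_mset1.
  by move=> x; rewrite in_mset1 => /eqP ->; apply: Dnf.
- by apply: (Dstep a) => //; apply: (Dmu (1, a)); rewrite in_mset1.
- move=> x /mem_bigmsetD[j] /mem_scale_supp[y yj ->].
  apply: (IH j) yj => z zj.
  by apply: (Dmu (p j * z.1, z.2)); apply/mem_bigmsetD; exists j; apply: mem_scale_dist.
Qed.

(** Both sides are linear in the multi-distribution, so the comparison passes from single terms to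
    convex combinations. *)
Lemma lifting_expect_le D f g :
  (forall a, D a -> normal_form step a -> f a <= g a) ->
  (forall a nu, D a -> step a nu -> expect nu f <= g a) ->
  forall mu nu, lifting step mu nu -> in_supp D mu -> expect nu f <= expect mu g.
Proof.
move=> Dnf Dstep mu nu; elim=> [a nfa|a {}nu st|k p {}mu {}nu p0 _ _ IH] Dmu.
- by rewrite !expect_dirac; apply: Dnf => //; apply: (Dmu (1, a)); rewrite in_mset1.
- by rewrite expect_dirac; apply: Dstep => //; apply: (Dmu (1, a)); rewrite in_mset1.
- rewrite !expect_big; apply: ler_sum => j _; rewrite !expect_scale.
  apply: ler_wpM2l; first exact: ltW.
  apply: IH => z zj.
  by apply: (Dmu (p j * z.1, z.2)); apply/mem_bigmsetD; exists j; apply: mem_scale_dist.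
Qed.

Lemma lifting_expect_ge0 f : (forall a, 0 <= f a) ->
  forall mu nu, lifting step mu nu -> 0 <= expect mu f.
Proof.
move=> f0 mu nu; elim=> [a _|a {}nu _|k p {}mu {}nu p0 _ _ IH].
- by rewrite expect_dirac.
- by rewrite expect_dirac.
- by rewrite expect_big sumr_ge0 // => j _; rewrite expect_scale mulr_ge0 // ltW.
Qed.

(** For an arbitrary [step] nothing is known about the mass of a target. In an infinite sequence
    every member is a source, so this suffices. *)
Lemma lifting_mass mu nu : lifting step mu nu -> expect mu (fun=> 1) = 1.
Proof.
elim=> [a _|a {}nu _|k p {}mu {}nu _ p1 _ IH]; rewrite ?expect_dirac //.
rewrite expect_big -{}[RHS]p1; apply: eq_bigr => j _.
by rewrite expect_scale IH mulr1.
Qed.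

Definition alive a : R := (~~ `[< normal_form step a >])%:R.

Lemma expect_alive mu :
  expect mu (fun=> 1) = 1 -> 1 - nf_prob step mu = expect mu alive.
Proof.
move=> <-; rewrite /nf_prob big_mkcond /= /expect -sumrB.
apply: eq_bigr => x _; rewrite /alive.
by case: ifP => _ /=; rewrite ?mulr0 ?mulr1 ?subrr ?subr0.
Qed.

(* The bound on the expected runtime may depend on the first step: no rank is
   required at terms outside [D], which are left after one step. *)
Lemma PAST_rank_after_step D (rk : A -> R) :
  (forall a, 0 <= rk a) ->
  (forall a, normal_form step a -> D a) ->
  (forall a nu, step a nu -> in_supp D nu) ->
  (forall a nu, D a -> step a nu -> expect nu rk + 1 <= rk a) ->
  PAST step.
Proof.
move=> rk0 Dnf Dstep rk_dec a mu mu0 lift.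
have aliveE n : 1 - nf_prob step (mu n) = expect (mu n) alive.
  exact/expect_alive/lifting_mass/lift.
have alive_ge0 b : 0 <= alive b by exact: ler0n.
have Emu_ge0 f n : (forall b, 0 <= f b) -> 0 <= expect (mu n) f.
  by move=> f0; apply: lifting_expect_ge0 f0 _ _ (lift n).
have Dmu n : in_supp D (mu n.+1).
  elim: n => [|n IHn].
  - by apply: (lifting_supp (D := xpredT)) (lift 0%N) _ => //= *;
      [exact: Dnf|apply: Dstep; eassumption].
  - by apply: (lifting_supp (D := D)) (lift n.+1) IHn => // *; apply: Dstep; eassumption.
(* Normal forms keep their rank and have [alive] equal to 0; all other terms lose at least 1, the
   value of [alive] there. *)
have dec n : expect (mu n.+2) rk <= expect (mu n.+1) rk - expect (mu n.+1) alive.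
  rewrite -expectB; apply: lifting_expect_le (lift n.+1) (Dmu n) => [b Db nfb|b nu Db st].
  - by rewrite /alive asboolT // subr0.
  - by rewrite /alive asboolF /= ?lerBrDr ?rk_dec// => nfb; apply: nfb; exists nu.
have bound n : \sum_(0 <= i < n) expect (mu i.+1) alive
    <= expect (mu 1%N) rk - expect (mu n.+1) rk.
  elim: n => [|n IHn]; first by rewrite big_geq // subrr.
  rewrite big_nat_recr //=; have := dec n; lra.
(* The summand of index 0 is kept apart, because the rank controls only what happens from [mu 1]
   on. *)
have Ebound : (\sum_(0 <= n <oo) (1 - nf_prob step (mu n))%:E
    <= (expect (mu 0%N) alive + expect (mu 1%N) rk)%:E)%E.
  have ge0 n : (0 <= (1 - nf_prob step (mu n))%:E)%E.
    by rewrite lee_fin aliveE Emu_ge0.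
  apply: lime_le; first exact: is_cvg_nneseries.
  apply: nearW => n; rewrite sumEFin lee_fin.
  under eq_bigr do rewrite aliveE.
  case: n => [|n]; first by rewrite big_geq // addr_ge0 // Emu_ge0.
  rewrite big_nat_recl // lerD2l.
  have := bound n; have := Emu_ge0 rk n.+1 rk0; lra.
by apply: le_lt_trans Ebound _; rewrite ltry.
Qed.

End Rank.

(** * Lower bounds on the runtime from a schedule given as a Markov chain on [T] *)

Section MarkovSchedule.
Variables (R : realType) (A : choiceType) (step : A -> multidist R A -> Prop).
Variables (T : Type) (tm : T -> A) (next : T -> seq (R * T)).

Let embed (s : seq (R * T)) : multidist R A := seq_mset [seq (x.1, tm x.2) | x <- s].

Hypothesis next_gt0 : forall x, all (fun y => 0 < y.1) (next x).
Hypothesis next_mass : forall x, \sum_(y <- next x) y.1 = 1.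
Hypothesis next_lifting : forall x, lifting step (dirac_dist R (tm x)) (embed (next x)).

(** Distributions over states are weighted lists, so that states need not be compared. *)
Definition advance (s : seq (R * T)) : seq (R * T) :=
  flatten [seq [seq (x.1 * y.1, y.2) | y <- next x.2] | x <- s].

(** The probability that the chain started at [x] is not at a normal form after [n] transitions,
    computed by splitting off the first one. *)
Fixpoint survival (n : nat) (x : T) : R :=
  if n is n'.+1 then \sum_(y <- next x) y.1 * survival n' y.2
  else alive step (tm x).

Lemma survival_ge0 n x : 0 <= survival n x.
Proof.
elim: n x => [|n IHn] x /=; first exact: ler0n.
elim: (next x) (next_gt0 x) => [|y s IHs] /=; first by rewrite big_nil.
by case/andP=> y0 /IHs s0; rewrite big_cons addr_ge0 // mulr_ge0 // ltW.
Qed.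

Lemma advance_gt0 s : all (fun y => 0 < y.1) s -> all (fun y => 0 < y.1) (advance s).
Proof.
elim: s => //= x s IHs /andP[x0 /IHs s0]; rewrite all_cat s0 andbT all_map.
by apply: sub_all (next_gt0 x.2) => y /= y0; rewrite mulr_gt0.
Qed.

Lemma sum_advance s (f : T -> R) :
  \sum_(x <- advance s) x.1 * f x.2
  = \sum_(x <- s) x.1 * \sum_(y <- next x.2) y.1 * f y.2.
Proof.
rewrite big_flatten big_map; apply: eq_bigr => x _.
by rewrite big_map mulr_sumr; apply: eq_bigr => y _; rewrite /= mulrA.
Qed.

Lemma advance_mass s : \sum_(x <- advance s) x.1 = \sum_(x <- s) x.1.
Proof.
transitivity (\sum_(x <- advance s) x.1 * 1); first by under [RHS]eq_bigr do rewrite mulr1.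
rewrite (sum_advance _ (fun=> 1)); apply: eq_bigr => x _.
by under eq_bigr do rewrite mulr1; rewrite next_mass mulr1.
Qed.

(** The list is a convex combination of Dirac distributions, one per entry, each of which is lifted
    by [next_lifting]. *)
Lemma lifting_advance s : all (fun y => 0 < y.1) s -> \sum_(x <- s) x.1 = 1 ->
  lifting step (embed s) (embed (advance s)).
Proof.
move=> s0 s1.
have -> : embed s =
    \big[@msetD _/mset0]_(x <- s) scale_dist x.1 (dirac_dist R (tm x.2)).
  rewrite /embed (eq_bigr (fun x => seq_mset [:: (x.1, tm x.2)])) => [|x _].
    by rewrite -(big_map (fun x => [:: (x.1, tm x.2)]) xpredT) big_msetD_flatten flatten_map1.
  by rewrite /dirac_dist -seq_mset1 scale_seq_mset /= mulr1.
have -> : embed (advance s) =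
    \big[@msetD _/mset0]_(x <- s) scale_dist x.1 (embed (next x.2)).
  rewrite /embed (eq_bigr (fun x => seq_mset
      [seq (y.1, tm y.2) | y <- [seq (x.1 * y.1, y.2) | y <- next x.2]])) => [|x _].
    rewrite -(big_map (fun x => [seq (y.1, tm y.2) | y <-
      [seq (x.1 * y.1, y.2) | y <- next x.2]]) xpredT) big_msetD_flatten.
    by rewrite map_flatten -map_comp.
  by rewrite scale_seq_mset -!map_comp.
rewrite big_tnth [X in lifting _ _ X]big_tnth; apply: lifting_convex => [j||j];
  last exact: next_lifting.
- by have /all_tnthP := s0 : all _ (in_tuple s); apply.
- by rewrite -(big_tnth _ _ s xpredT (fun x => x.1)).
Qed.

(** Iterating [advance] gives an infinite lifting sequence whose summands are the survival
    probabilities. They are nonnegative, so the finite limit bounds all partial sums. *)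
Lemma PAST_survival_bounded x : PAST step ->
  exists M : R, forall N, \sum_(0 <= n < N) survival n x <= M.
Proof.
pose run n := iter n advance [:: (1, x)] => past.
have run_gt0 n : all (fun y => 0 < y.1) (run n).
  by elim: n => [|n /advance_gt0//]; rewrite /= ltr01.
have run_mass n : \sum_(y <- run n) y.1 = 1.
  by elim: n => [|n IHn]; rewrite ?big_seq1 //= advance_mass.
(* [run] grows at the last transition and [survival] at the first; the free [m] lets the induction
   move transitions from one to the other. *)
have runE n m : \sum_(y <- run n) y.1 * survival m y.2 = survival (n + m) x.
  elim: n m => [|n IHn] m; first by rewrite big_seq1 mul1r.
  by rewrite [run _]/= sum_advance addSnnS -IHn.
have nfE n : 1 - nf_prob step (embed (run n)) = survival n x.
  rewrite expect_alive; first by rewrite expect_seq_mset big_map -[n in RHS]addn0 -runE.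
  by rewrite expect_seq_mset big_map -[RHS](run_mass n); under eq_bigr do rewrite mulr1.
have fin : (\sum_(0 <= n <oo) (1 - nf_prob step (embed (run n)))%:E < +oo)%E.
  apply: (past (tm x)) => [|n]; first by rewrite /embed /= seq_mset1.
  exact: lifting_advance.
have ge0 n : (0 <= (1 - nf_prob step (embed (run n)))%:E)%E.
  by rewrite lee_fin nfE survival_ge0.
exists (fine (\sum_(0 <= n <oo) (1 - nf_prob step (embed (run n)))%:E)%E) => N.
rewrite -lee_fin fineK; last by rewrite ge0_fin_numE // nneseries_ge0.
rewrite -sumEFin; under eq_bigr do rewrite -nfE.
exact: nneseries_lim_ge.
Qed.

End MarkovSchedule.

(** * The signature and the rules *)

Inductive symbol :=
| Coin of nat | Stop of nat | Choose | Count of nat | Pair.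

Definition symbol_code (f : symbol) : nat * nat :=
  match f with
  | Coin k => (0, k) | Stop k => (1, k) | Choose => (2, 0)
  | Count m => (3, m) | Pair => (4, 0)
  end%N.

Definition symbol_decode (c : nat * nat) : option symbol :=
  match c with
  | (0, k) => Some (Coin k) | (1, k) => Some (Stop k) | (2, _) => Some Choose
  | (3, m) => Some (Count m) | (4, _) => Some Pair | _ => None
  end%N.

Lemma symbol_codeK : pcancel symbol_code symbol_decode.
Proof. by case. Qed.

HB.instance Definition _ := Countable.copy symbol (pcan_type symbol_codeK).

Definition arity (f : symbol) : nat := if f is Pair then 2 else 0.

Definition constants : set symbol := [set f | arity f = 0%N].

Definition cst (f : symbol) : tree symbol := App f [::].

Lemma subtree_at_cst f pi u :
  subtree_at (cst f) pi = Some u -> pi = [::] /\ u = cst f.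
Proof. by case: pi => [[<-]|]. Qed.

Section CounterExample.
Variable R : realType.

(** Indexing the rules reduces their countability to an injection into pairs of naturals. *)
Variant rule_index := Toss of nat | Pick of nat | Tick of nat.

Definition rule_index_code (i : rule_index) : nat * nat :=
  match i with Toss k => (0, k) | Pick m => (1, m) | Tick m => (2, m) end%N.

Lemma rule_index_code_inj : injective rule_index_code.
Proof. by case=> ? [?|?|?] // [->]. Qed.

Definition lhs (i : rule_index) : symbol :=
  match i with
  | Toss k => Coin k
  | Pick _ => Choose
  | Tick m => Count m.+1
  end.

Definition rhs (i : rule_index) : seq (R * symbol) :=
  match i with
  | Toss k => [:: (2^-1, Coin k.+1); (2^-1, Stop k)]
  | Pick m => [:: (1, Count m)]
  | Tick m => [:: (1, Count m)]
  end.

Definition rule_of (i : rule_index) : rule R symbol :=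
  (cst (lhs i), seq_mset [seq (x.1, cst x.2) | x <- rhs i]).

Definition rules : set (rule R symbol) := range rule_of.

Lemma countable_rules : countable rules.
Proof.
apply: sub_countable (card_image_le _ _) _.
apply/countable_injP; exists (choice.pickle \o rule_index_code).
by apply: in2W; apply: inj_comp rule_index_code_inj; apply: pcan_inj choice.pickleK.
Qed.

Lemma rhs_constant i x : x \in rhs i -> x.2 \in constants.
Proof.
by case: i => n; rewrite !inE; [case/orP|..] => /eqP->.
Qed.

Lemma rhs_mass i : \sum_(x <- rhs i) x.1 = 1.
Proof. by case: i => n; rewrite /rhs ?big_cons big_nil /=; lra. Qed.

Lemma rhs_weight i x : x \in rhs i -> 0 < x.1 <= 1.
Proof.
by case: i => n; rewrite !inE; [case/orP|..] => /eqP-> /=; lra.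
Qed.

Lemma wf_cst S f : f \in S -> arity f = 0%N -> wf arity S (cst f).
Proof. by move=> /= -> ->. Qed.

Lemma arity_lhs i : arity (lhs i) = 0%N.
Proof. by case: i. Qed.

Lemma is_PTRS_rules : is_PTRS arity constants rules.
Proof.
split=> [|l rho [i _ [<- <-]]]; first exact: countable_rules.
split=> //.
- by apply: wf_cst (arity_lhs i); rewrite inE /constants /= arity_lhs.
- split=> [x|]; first by rewrite mem_seq_mset => /mapP[y /rhs_weight ? ->].
  by rewrite big_seq_mset big_map rhs_mass.
- move=> x; rewrite mem_seq_mset => /mapP[y yi ->] /=.
  have yS := rhs_constant yi; split=> //.
  by apply: wf_cst => //; move: yS; rewrite inE.
Qed.

(** * Rewrite steps over an arbitrary signature *)

Section AnySignature.
Variable S : set symbol.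
Implicit Types (t : term arity S) (mu : multidist R (term arity S)).

(** All sides of the rules are ground, so the substitution disappears. *)
Lemma full_step_redex t mu : full_step rules t mu -> exists i pi,
  subtree_at t pi = Some (cst (lhs i)) /\
  map_dist (@term_val _ _ _) mu
  = seq_mset [seq (x.1, replace_at t pi (cst x.2)) | x <- rhs i].
Proof.
move=> [l [sigma [pi [rho [[i _ [<- <-]] /= sub ->]]]]].
by exists i, pi; split=> //; rewrite map_dist_seq_mset -map_comp.
Qed.

Lemma rewrite_step_full s t mu :
  rewrite_step arity S rules s t mu -> full_step rules t mu.
Proof.
by case: s => // -[l [sigma [pi []]]] *; exists l, sigma, pi.
Qed.

(** One criterion serves all three strategies: a constant has no proper subterms, so the step is
    innermost, and the last hypothesis excludes redexes further left. *)
Lemma rewrite_stepI s t mu i j :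
  subtree_at t [:: j] = Some (cst (lhs i)) ->
  map_dist (@term_val _ _ _) mu
    = seq_mset [seq (x.1, replace_at t [:: j] (cst x.2)) | x <- rhs i] ->
  (forall j' i' pi, (j' < j)%N -> subtree_at t (j' :: pi) <> Some (cst (lhs i'))) ->
  rewrite_step arity S rules s t mu.
Proof.
move=> sub muE left.
pose sigma (n : nat) : term arity S := @Term _ arity S (Var n) isT.
have rew : rewrites_at rules t mu (cst (lhs i)) sigma [:: j].
  exists (rule_of i).2; split=> //; first by exists i.
  by rewrite muE map_dist_seq_mset -map_comp.
have inn : @innermost_redex R _ arity S rules (subst sigma (cst (lhs i))).
  by move=> v [pi pi0 /subtree_at_cst[pi_nil _]]; rewrite pi_nil in pi0.
case: s => /=; exists (cst (lhs i)), sigma, [:: j] => //; split=> //.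
move=> [tau [rho [tau' [pi' [i0 [j0 [-> jE lt]]]]]]].
move=> [_ [_ [sigma' [[i' _ [<- _]]]]]].
(* The position [[:: j]] has length one, so the common prefix [rho] is empty. *)
case: rho jE => [|n [|??]] //= [jE _]; rewrite -jE in lt.
exact: left.
Qed.

End AnySignature.

(** * Positive almost sure termination over the constants *)

Lemma constant_term (t : term arity constants) :
  (exists x, term_val t = Var x) \/ (exists f, term_val t = cst f).
Proof.
case: t => -[x|f ts] /=; first by left; exists x.
case/and3P; rewrite inE => f0 ts0 _; right; exists f.
by rewrite /cst; congr App; apply: size0nil; rewrite (eqP ts0).
Qed.

Lemma constant_full_step (t : term arity constants) mu :
  full_step rules t mu -> exists i, term_val t = cst (lhs i) /\
  map_dist (@term_val _ _ _) mu = seq_mset [seq (x.1, cst x.2) | x <- rhs i].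
Proof.
case/full_step_redex => i [pi].
case: (constant_term t) => [[x ->]|[f ->]]; first by case: pi => [|? ?] [].
by case=> /subtree_at_cst[-> [<-]] ->; exists i.
Qed.

(** The value 2 is the expected number of tosses. No finite value for [Choose] could dominate every
    [Count m]; its value 0 is a default. *)
Definition rank (t : tree symbol) : R :=
  match t with
  | App (Coin _) _ => 2
  | App (Count m) _ => m%:R
  | _ => 0
  end.

(** [Choose] occurs in no right-hand side, so over constants it can only be the initial term, and
    one step leads to terms where the rank decreases. *)
Lemma PAST_constants s : PAST (rewrite_step arity constants rules s).
Proof.
set step := rewrite_step _ _ _ _.
apply: (@PAST_rank_after_step _ _ _
  (* Stated as an implication, the predicate holds at every normal form by construction. *)
  (fun t => term_val t = cst Choose -> normal_form step t)
  (fun t => rank (term_val t))) => //.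
- by move=> t; case: (term_val t) => [//|[] /= *]; rewrite ?ler0n.
- move=> t nu /rewrite_step_full/constant_full_step[i [_ nuE]] x xnu xC.
  have : (x.1, term_val x.2) \in map_dist (@term_val _ _ _) nu.
    by rewrite mem_seq_mset; apply/mapP; exists x.
  rewrite nuE mem_seq_mset => /mapP[y yi [_]]; rewrite xC => -[yC].
  by case: i yi {nuE} => n; rewrite !inE; [case/orP|..] => /eqP yE; rewrite yE in yC.
- move=> t nu tC st; have [i [tE nuE]] := constant_full_step (rewrite_step_full st).
  rewrite -(expect_map _ _ rank) nuE expect_seq_mset big_map tE.
  case: i tE {nuE} => n tE; rewrite /= ?big_cons big_nil /=.
  + lra.
  + by case: (tC tE); exists nu.
  + by rewrite mul1r addr0 -natr1.
Qed.

(** * Divergence over the signature with [Pair] *)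

Definition pair_tree (f g : symbol) : tree symbol := App Pair [:: cst f; cst g].

Lemma wf_pair f g : arity f = 0%N -> arity g = 0%N -> wf arity setT (pair_tree f g).
Proof. by move=> f0 g0; rewrite /= f0 g0 !in_setT. Qed.

Variant state := Tossing of nat | Choosing of nat | Counting of nat & nat.

Definition state_term (x : state) : term arity setT :=
  match x with
  | Tossing k => Term (@wf_pair (Coin k) Choose erefl erefl)
  | Choosing k => Term (@wf_pair (Stop k) Choose erefl erefl)
  | Counting k m => Term (@wf_pair (Stop k) (Count m) erefl erefl)
  end.

(* When the coin stopped after k tosses, an event of probability 2^-(k+1), the
   schedule picks a countdown of length 2^(k+1). *)
Definition next (x : state) : seq (R * state) :=
  match x with
  | Tossing k => [:: (2^-1, Tossing k.+1); (2^-1, Choosing k)]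
  | Choosing k => [:: (1, Counting k (2 ^ k.+1)%N)]
  | Counting k m => [:: (1, Counting k m.-1)]
  end.

Lemma stop_not_redex k i pi : subtree_at (cst (Stop k)) pi <> Some (cst (lhs i)).
Proof. by case/subtree_at_cst=> _; case: i. Qed.

Lemma state_step s x : (forall k, x <> Counting k 0) ->
  rewrite_step arity setT rules s (state_term x)
    (seq_mset [seq (y.1, state_term y.2) | y <- next x]).
Proof.
case: x => [k|k|k [|m]] x0.
- apply: (@rewrite_stepI _ _ _ _ (Toss k) 0%N) => //.
  by rewrite map_dist_seq_mset.
- apply: (@rewrite_stepI _ _ _ _ (Pick (2 ^ k.+1)%N) 1%N) => //.
    by rewrite map_dist_seq_mset.
  by move=> [|//] i pi _ /=; apply: stop_not_redex.
- by case: (x0 k).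
- apply: (@rewrite_stepI _ _ _ _ (Tick m) 1%N) => //.
    by rewrite map_dist_seq_mset.
  by move=> [|//] i pi _ /=; apply: stop_not_redex.
Qed.

Lemma normal_form_counted s k :
  normal_form (rewrite_step arity setT rules s) (state_term (Counting k 0)).
Proof.
case=> mu /rewrite_step_full/full_step_redex[i [pi [+ _]]].
case: pi => [|[|[|//]] pi] /=.
- by case: i.
- exact: stop_not_redex.
- by case/subtree_at_cst=> _; case: i.
Qed.

(** At [Counting k 0] the truncated predecessor turns [next] into a self-loop, as [lifting_nf]
    demands at a normal form. *)
Lemma state_lifting s x :
  lifting (rewrite_step arity setT rules s) (dirac_dist R (state_term x))
    (seq_mset [seq (y.1, state_term y.2) | y <- next x]).
Proof.
case: (pselect (exists k, x = Counting k 0)) => [[k ->]|x0].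
  by rewrite /= seq_mset1; apply: lifting_nf; apply: normal_form_counted.
by apply/lifting_step/state_step => k xE; apply: x0; exists k.
Qed.

Lemma next_gt0 x : all (fun y => 0 < y.1) (next x).
Proof. by case: x => [k|k|k m] /=; rewrite ?andbT; lra. Qed.

Lemma next_mass x : \sum_(y <- next x) y.1 = 1.
Proof. by case: x => [k|k|k m]; rewrite /next ?big_cons big_nil /=; lra. Qed.

Section Divergence.
Variable s : strategy.
Let surv := survival (rewrite_step arity setT rules s) state_term next.
(** The expected runtime from [x], truncated at [N] steps. *)
Let total N x := \sum_(0 <= n < N) surv n x.

Lemma surv_ge0 n x : 0 <= surv n x.
Proof. exact: survival_ge0 next_gt0 _ _. Qed.

Lemma totalS N x :
  total N.+1 x = surv 0 x + \sum_(y <- next x) y.1 * total N y.2.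
Proof.
rewrite /total big_nat_recl //; congr (_ + _).
by rewrite exchange_big; apply: eq_bigr => y _; rewrite mulr_sumr.
Qed.

Lemma total_le N N' x : (N <= N')%N -> total N x <= total N' x.
Proof.
move=> le; rewrite /total (big_cat_nat (leq0n N) le) /= lerDl sumr_ge0 // => n _.
exact: surv_ge0.
Qed.

Lemma total_counting k m : m%:R <= total m (Counting k m).
Proof.
elim: m => [|m IHm]; first by rewrite /total big_geq.
have surv1 : surv 0 (Counting k m.+1) = 1.
  rewrite /surv /= /alive asboolF // => nf; apply: nf.
  by eexists; exact: (@state_step s (Counting k m.+1)).
by rewrite totalS big_seq1 mul1r surv1 -natr1 addrC lerD2l.
Qed.

(** Half of the mass moves to [Tossing k.+1] and contributes d * 2^(k+1) / 2 by induction; the other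
    half starts a countdown and contributes at least 2^(k+1) / 2. The sum is (d+1) * 2^k. *)
Lemma total_tossing d k : exists N, d%:R * 2 ^+ k <= total N (Tossing k).
Proof.
elim: d k => [|d IHd] k; first by exists 0%N; rewrite mul0r /total big_geq.
have [N dN] := IHd k.+1.
(* Long enough for both branches: the second needs one step to pick and 2^(k+1) steps to count
   down. *)
pose N' := maxn N (2 ^ k.+1).+1.
exists N'.+1; rewrite totalS big_cons big_seq1 /=.
have := surv_ge0 0 (Tossing k).
have := le_trans dN (total_le _ (leq_maxl N (2 ^ k.+1).+1)).
have : 2 ^+ k.+1 <= total N' (Choosing k).
  apply: le_trans (total_le _ (leq_maxr N (2 ^ k.+1).+1)).
  rewrite totalS big_seq1 mul1r -natrX.
  by apply: le_trans (total_counting k _) _; rewrite lerDr surv_ge0.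
rewrite -/N' -[d.+1%:R]natr1 exprS; move: (2 ^+ k) => z; lra.
Qed.

Lemma not_PAST_pairs : ~ PAST (rewrite_step arity setT rules s).
Proof.
move=> /(PAST_survival_bounded next_gt0 next_mass (state_lifting s) (Tossing 0)).
case=> M bound.
(* At [k = 0] the lower bound is [d] itself, here an integer above [M]. *)
have [N] := total_tossing (Num.truncn M).+1 0.
rewrite expr0 mulr1 => /le_trans/(_ (bound N)).
by rewrite leNgt truncnS_gt.
Qed.

End Divergence.

End CounterExample.

Theorem theorem3p16 (R : realType) (s : strategy) :
  exists (F : countType) (ar : F -> nat) (Sigma Sigma' : set F)
         (P : set (rule R F)),
    [/\ Sigma `<` Sigma',
        is_PTRS ar Sigma P,
        PAST (rewrite_step ar Sigma P s)
      & ~ PAST (rewrite_step ar Sigma' P s)].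
Proof.
exists symbol, arity, constants, setT, (@rules R); split.
- by split=> // /(_ Pair I).
- exact: is_PTRS_rules.
- exact: PAST_constants.
- exact: not_PAST_pairs.
Qed.
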